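(* Consider ${\rm CHC}_D(\mathbf k,\mathbf n,\lambda)$ under regime (A1) and the test $\psi^c=\psi_{sum}\vee\psi_{max}$ with threshold $W\to\infty$. If either (i) $\dfrac{\lambda\prod_ik_i}{\sqrt{\prod_in_i}}\to\infty$ and $W\le c\,\lambda\dfrac{\prod_ik_i}{\sqrt{\prod_in_i}}$ for some fixed $0<c<1$; or (ii) $\liminf\dfrac{\lambda}{\sqrt{2\sum_{i=1}^d\log n_i}}>1$, then $\mathbb P_0(\psi^c=1)+\sup_{\mathcal X\in\mathscr X_{\rm CHC}(\mathbf k,\mathbf n,\lambda)}\mathbb P_{\mathcal X}(\psi^c=0)\to0$. Under regime (A2) (with a suitable choice of $W$), $\psi^c$ achieves reliable detection when $\beta<(d\alpha-d/2)\vee0$.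
   Context: Model: $\mathcal Y=\mathcal X+\mathcal Z\in\mathbb R^{n_1\times\cdots\times n_d}$, $\mathcal Z$ i.i.d. $N(0,1)$; ${\rm CHC}_D$ tests $H_0:\mathcal X=0$ vs $H_1:\mathcal X\in\mathscr X_{\rm CHC}(\mathbf k,\mathbf n,\lambda)=\{\lambda'\mathbf 1_{I_1}\circ\cdots\circ\mathbf 1_{I_d}:|I_i|=k_i,\lambda'\ge\lambda\}$. $\psi_{sum}=\mathbf 1\big(\sum_{i_1,\dots,i_d}\mathcal Y_{[i_1,\dots,i_d]}/\sqrt{n_1\cdots n_d}>W\big)$; $\psi_{max}=\mathbf 1\big(\max_{i_1,\dots,i_d}\mathcal Y_{[i_1,\dots,i_d]}>\sqrt{2\sum_{i=1}^d\log n_i}\big)$. Regime (A1): $n_i\to\infty,k_i\to\infty,k_i/n_i\to0$ for all $i$. Regime (A2): fixed $\alpha\in[0,1],\beta\in\mathbb R$; $n\to\infty$, $\log n_i/\log n\to1$, $k_i=k$ with $\log k/\log n\to\alpha$, $\log(1/\lambda)/\log n\to\beta$. *)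

(* Defs.v *)
From HB Require Import structures.
From mathcomp Require Import all_boot all_order all_algebra.
From mathcomp Require Import all_classical all_reals all_analysis.
Set Implicit Arguments. Unset Strict Implicit. Unset Printing Implicit Defensive.
Import Order.TTheory GRing.Theory Num.Theory.
Local Open Scope classical_set_scope.
Local Open Scope ring_scope.

Definition Idx (d : nat) (n : 'I_d -> nat) : finType :=
  {dffun forall j : 'I_d, 'I_(n j)}.

Definition std_gaussian_tensor {R : realType} {dT : measure_display}
    {T : measurableType dT} (P : probability T R) (d : nat) (n : 'I_d -> nat)
    (Z : Idx n -> T -> R) : Prop :=
  [/\ (forall i, measurable_fun setT (Z i)),
      (forall i (B : set R), measurable B ->
          P (Z i @^-1` B) = normal_prob 0 1 B) &
      (forall B : Idx n -> set R, (forall i, measurable (B i)) ->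
          P (\bigcap_(i in [set: Idx n]) (Z i @^-1` B i)) =
          (\prod_(i : Idx n) P (Z i @^-1` B i))%E)].

(* lam' * 1_{I_1} o ... o 1_{I_d} *)
Definition chc_tensor {R : realType} (d : nat) (n : 'I_d -> nat) (lam' : R)
    (I : forall j : 'I_d, {set 'I_(n j)}) : Idx n -> R :=
  fun i => if [forall j : 'I_d, i j \in I j] then lam' else 0.

Definition chc_class {R : realType} (d : nat) (n k : 'I_d -> nat) (lam : R)
    : set (Idx n -> R) :=
  [set X | exists (lam' : R) (I : forall j : 'I_d, {set 'I_(n j)}),
      lam <= lam' /\ (forall j, #|I j| = k j) /\ X = chc_tensor lam' I].

Definition psi_sum {R : realType} (d : nat) (n : 'I_d -> nat) (W : R)
    (Y : Idx n -> R) : bool :=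
  W < (\sum_(i : Idx n) Y i) / Num.sqrt (\prod_(j < d) (n j)%:R).

Definition psi_max {R : realType} (d : nat) (n : 'I_d -> nat)
    (Y : Idx n -> R) : bool :=
  [exists i : Idx n,
     Num.sqrt (2 * \sum_(j < d) ln ((n j)%:R : R)) < Y i].

Definition psi_c {R : realType} (d : nat) (n : 'I_d -> nat) (W : R)
    (Y : Idx n -> R) : bool := psi_sum W Y || psi_max Y.

Definition chc_risk {R : realType} {dT : measure_display}
    {T : measurableType dT} (P : probability T R) (d : nat)
    (n k : 'I_d -> nat) (lam W : R) (Z : Idx n -> T -> R) : \bar R :=
  (P [set w | psi_c W (fun i => Z i w)] +
   ereal_sup [set P [set w | ~~ psi_c W (fun i => (X i + Z i w)%R)]
             | X in @chc_class R d n k lam])%E.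

(* Main.v *)
Require Import Defs.
From HB Require Import structures.
From mathcomp Require Import all_boot all_order all_algebra.
From mathcomp Require Import all_classical all_reals all_analysis.
From mathcomp Require Import measurable_realfun ring lra.
Import Order.TTheory GRing.Theory Num.Theory.
Import numFieldNormedType.Exports.
Set Implicit Arguments. Unset Strict Implicit. Unset Printing Implicit Defensive.
Local Open Scope classical_set_scope.
Local Open Scope ring_scope.

(**
  The statistic of the sum test is centred with bounded variance under the null
  (the noise entries are pairwise uncorrelated), and the signal shifts it by at
  least lam * prod k / sqrt (prod n); Chebyshev's inequality thus controls both
  of its errors. For the max test, Mills' inequality at t = sqrt (2 ln N),
  N = prod n, makes the union bound N * P(Z > t) of order 1 / t, and under the
  alternative a single entry of the planted block, again with Chebyshev, already
  exceeds t. Each test only has to be powerful in its own regime, since the union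
  of the two tests misses less often than either of them. In regime (A2) the
  logarithm of the signal strength, resp. of lam, is a positive multiple of ln n.
*)

(** * The standard normal law *)

(** The Radon-Nikodym derivative of the law and [normal_pdf] have the same integral over every
    measurable set, so they agree almost everywhere and may be exchanged under the integral. *)
Lemma ge0_integral_normal_prob (R : realType) (m s : R) (f : R -> \bar R) :
  measurable_fun setT f -> (forall x, 0 <= f x)%E ->
  (\int[normal_prob m s]_x f x =
   \int[lebesgue_measure]_x (f x * (normal_pdf m s x)%:E))%E.
Proof.
move=> mf f0.
have dom := normal_prob_dominates m s.
have mpdf : measurable_fun [set: R] (EFin \o normal_pdf m s).
  by apply/measurable_EFinP; exact: measurable_normal_pdf.
have mRN := measurable_int _ (Radon_Nikodym_SigmaFinite.f_integrable dom).
rewrite -(Radon_Nikodym_SigmaFinite.change_of_variables dom)//.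
apply: ae_eq_integral => //.
- exact: emeasurable_funM.
- exact: emeasurable_funM.
- apply: ae_eqe_mul2l; apply: integral_ae_eq => //.
  + exact: Radon_Nikodym_SigmaFinite.f_integrable.
  + by move=> E _ mE; rewrite -Radon_Nikodym_SigmaFinite.f_integral.
Qed.

(** Completing the square: [r * x - x^2 / 2 = r^2 / 2 - (x - r)^2 / 2]. *)
Lemma expR_mul_normal_pdf (R : realType) (r x : R) :
  expR (r * x) * normal_pdf 0 1 x = expR (r ^+ 2 / 2) * normal_pdf r 1 x.
Proof.
rewrite !normal_pdfE ?oner_neq0// /normal_fun mulrCA [RHS]mulrCA -!expRD.
by congr (_ * expR _); field.
Qed.

Lemma normal_mgf (R : realType) (r : R) :
  (\int[normal_prob 0 1]_x (expR (r * x))%:E = (expR (r ^+ 2 / 2))%:E)%E.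
Proof.
rewrite ge0_integral_normal_prob.
- under eq_integral do rewrite -EFinM expR_mul_normal_pdf EFinM.
  rewrite integralZl//; last exact: integrable_normal_pdf.
  by rewrite integral_normal_pdf mule1.
- by apply/measurable_EFinP; apply: measurableT_comp.
- by move=> x; rewrite lee_fin expR_ge0.
Qed.

(** The tail lies outside [[0, x]], which carries mass [1 - expR (- rate * x)] out of a total of
    1. *)
Lemma exponential_tail_le (R : realType) (rate x : R) : 0 < rate -> 0 < x ->
  (exponential_prob rate `]x, +oo[ <= (expR (- rate * x))%:E)%E.
Proof.
move=> r0 x0.
have mexp : measurable_fun [set: R] (EFin \o exponential_pdf rate).
  by apply/measurable_EFinP; exact: measurable_exponential_pdf.
have pdf0 y : (0 <= (exponential_pdf rate y)%:E)%E.
  by rewrite lee_fin exponential_pdf_ge0// ltW.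
have mI : measurable (`[0%R, x] : set R) by [].
have := integral_exponential_pdf r0.
rewrite -(setUv `[0%R, x]) ge0_integral_setU//=; last 3 first.
- exact: measurableC.
- exact: measurable_funTS.
- exact/disj_setPCl.
rewrite -/(exponential_prob rate _) exponential_prob_itv0c//.
set I := (\int[_]_(_ in ~` _) _)%E => h.
have -> : (expR (- rate * x))%:E = I.
  by move: h; case: I => [y||]//= [h]; congr EFin; lra.
rewrite {h}/I.
apply: ge0_subset_integral => //.
- exact: measurableC.
- exact: measurable_funTS.
- move=> y/=; rewrite !in_itv/= andbT => xy; apply/negP.
  by rewrite negb_and -!ltNge xy orbT.
Qed.

(* Mills' inequality, by comparison with the exponential law of rate [t]:
   [(x - t)^2 >= 0] gives [- x^2 / 2 <= t^2 / 2 - t * x]. *)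
Lemma normal_tail (R : realType) (t : R) : 0 < t ->
  (normal_prob 0 1 `]t, +oo[ <= (normal_peak 1 * expR (- (t ^+ 2 / 2)) / t)%:E)%E.
Proof.
move=> t0.
(* The last factor is the exponential tail bound at [t]; the constant [c] keeps the division by [t],
   which cancels the rate in the exponential density. *)
have -> : expR (- (t ^+ 2 / 2)) = expR (t ^+ 2 / 2) * expR (- t * t) :> R.
  by rewrite -expRD; congr expR; field.
rewrite mulrA mulrAC EFinM.
set c := normal_peak 1 * _ / t.
have c0 : 0 <= c.
  by rewrite divr_ge0 ?(ltW t0)// mulr_ge0 ?expR_ge0 ?normal_peak_ge0.
have mexp : measurable_fun [set: R] (EFin \o exponential_pdf t).
  by apply/measurable_EFinP; exact: measurable_exponential_pdf.
apply: (@le_trans _ _ (c%:E * exponential_prob t `]t, +oo[)%E); last first.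
  by rewrite lee_wpmul2l ?lee_fin// exponential_tail_le.
rewrite /normal_prob /exponential_prob -ge0_integralZl//; last 2 first.
- exact: measurable_funTS.
- by move=> x _; rewrite lee_fin exponential_pdf_ge0// ltW.
apply: ge0_le_integral => //.
- by move=> x _; rewrite lee_fin normal_pdf_ge0.
- by apply: measurable_funTS; apply/measurable_EFinP; exact: measurable_normal_pdf.
- by apply: measurable_funTS; apply: emeasurable_funM.
- move=> x /=; rewrite in_itv/= andbT => tx.
  rewrite -EFinM lee_fin exponential_pdfE; last by rewrite ltW// (lt_trans t0).
  rewrite normal_pdfE ?oner_neq0// /normal_fun mulrA divfK ?gt_eqF//.
  rewrite -mulrA -expRD ler_pM2l ?normal_peak_gt0 ?oner_neq0// ler_expR.
  rewrite subr0 expr1n.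
  have := sqr_ge0 (x - t); nra.
Qed.

(** * Moments and uncorrelatedness *)

Lemma Lfun2P (R : realType) (dT : measure_display) (T : measurableType dT)
    (P : probability T R) (X : T -> R) : measurable_fun setT X ->
  (\int[P]_w (X w ^+ 2)%:E < +oo)%E -> X \in Lfun P 2%:E.
Proof.
move=> mX X2; rewrite inE; apply/andP; split; rewrite inE//=.
rewrite /finite_norm unlock /Lnorm; apply: poweR_lty.
rewrite [ltLHS](_ : _ = \int[P]_w (X w ^+ 2)%:E)%E//.
by apply: eq_integral => w _; rewrite /= powR_mulrn// real_normK ?num_real.
Qed.

(** The joint law and the product of the marginal laws agree on rectangles, hence everywhere;
    Fubini's theorem then separates the integral of [x * y]. *)
Lemma expectation_mul_indep (R : realType) (dT : measure_display)
    (T : measurableType dT) (P : probability T R) (X Y : T -> R) :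
  X \in Lfun P 2%:E -> Y \in Lfun P 2%:E ->
  (forall A B : set R, measurable A -> measurable B ->
     P (X @^-1` A `&` Y @^-1` B) = P (X @^-1` A) * P (Y @^-1` B))%E ->
  ('E_P[X \* Y] = 'E_P[X] * 'E_P[Y])%E.
Proof.
move=> X2 Y2 ind.
have Pfin : P setT \is a fin_num := fin_num_measure P _ measurableT.
have X1 := Lfun_subset12 Pfin X2.
have Y1 := Lfun_subset12 Pfin Y2.
have iXY : P.-integrable setT (EFin \o (X \* Y)).
  by apply/Lfun1_integrable; exact: Lfun2_mul_Lfun1.
have iX : P.-integrable setT (EFin \o X) by exact/Lfun1_integrable.
have iY : P.-integrable setT (EFin \o Y) by exact/Lfun1_integrable.
have mX : measurable_fun setT X by apply/measurable_EFinP; exact: (measurable_int P).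
have mY : measurable_fun setT Y by apply/measurable_EFinP; exact: (measurable_int P).
pose X' : {mfun T >-> R} := HB.pack X (isMeasurableFun.Build _ _ _ _ X mX).
pose Y' : {mfun T >-> R} := HB.pack Y (isMeasurableFun.Build _ _ _ _ Y mY).
have mW : measurable_fun setT (fun w => (X w, Y w)) by exact: measurable_fun_pair.
pose W : {mfun T >-> (R * R)%type} := HB.pack (fun w => (X w, Y w))
   (isMeasurableFun.Build _ _ _ _ _ mW).
pose f (z : R * R) : \bar R := (z.1 * z.2)%:E.
have mf : measurable_fun setT f.
  by apply/measurable_EFinP; apply: measurable_funM.
have lawW A : measurable A ->
    (distribution P X' \x distribution P Y')%E A = distribution P W A.
  apply: product_measure_unique => B C mB mC.
  exact: ind.
have -> : ('E_P[X \* Y] = \int[distribution P W]_z f z)%E.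
  by rewrite unlock integral_distribution.
have iW : (distribution P W).-integrable setT f.
  exact: integrable_pushforward.
have eW (g : R * R -> \bar R) :
    (\int[distribution P W]_z g z =
     \int[distribution P X' \x distribution P Y']_z g z)%E.
  by apply: eq_measure_integral => A mA _; apply/esym; exact: lawW.
(* The integrability that Fubini requires is transported from the joint law, where it is that of the
   product of [X] and [Y]. *)
have iXY' : (distribution P X' \x distribution P Y')%E.-integrable setT f.
  apply/integrableP; split => //; rewrite -eW.
  by have /integrableP[] := iW.
rewrite eW -integral12_prod_meas1//=.
rewrite /fubini_F/=.
have eYc : ('E_P[Y] = (fine 'E_P[Y])%:E)%E by rewrite fineK// expectation_fin_num.
transitivity (\int[distribution P X']_x (x%:E * (fine 'E_P[Y])%:E))%E.
  apply: eq_integral => x _; rewrite -eYc unlock.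
  rewrite /f/=; under eq_integral do rewrite EFinM.
  rewrite integralZl//; first by rewrite integral_distribution//.
  exact: integrable_pushforward.
rewrite integralZr//; last exact: integrable_pushforward.
by rewrite -eYc unlock integral_distribution.
Qed.

(** Markov's inequality for the square, stated with an upper bound [v] on the uncentred second
    moment. *)
Lemma markov_sqr (R : realType) (dT : measure_display) (T : measurableType dT)
    (P : probability T R) (S : T -> R) (a v : R) :
  measurable_fun setT S -> 0 < a -> (\int[P]_w (S w ^+ 2)%:E <= v%:E)%E ->
  (P [set w | (a <= `|S w|)%R] <= (v / a ^+ 2)%:E)%E.
Proof.
move=> mS a0 Sv.
pose S' : {RV P >-> R} := HB.pack S (isMeasurableFun.Build _ _ _ _ S mS).
rewrite EFinM lee_pdivlMr ?exprn_gt0// muleC; apply: le_trans Sv.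
apply: le_trans (@markov _ _ _ P S' (fun x => x ^+ 2) a a0 _ _ _) _ => //.
- by move=> r _; exact: sqr_ge0.
- by move=> x y; rewrite !nnegrE => x0 y0; rewrite ler_sqr.
- rewrite unlock; apply: ge0_le_integral => //.
  + by move=> x _; rewrite lee_fin sqr_ge0.
  + by apply/measurable_EFinP; apply: measurableT_comp => //; exact: measurableT_comp.
  + by apply/measurable_EFinP; exact: measurable_funX.
  + by move=> w _ /=; rewrite lee_fin real_normK ?num_real.
Qed.

Lemma ge0_expectation_normal (R : realType) (dT : measure_display)
    (T : measurableType dT) (P : probability T R) (X : T -> R) (f : R -> \bar R) :
  measurable_fun setT X ->
  (forall B : set R, measurable B -> P (X @^-1` B) = normal_prob 0 1 B) ->
  measurable_fun setT f -> (forall x, 0 <= f x)%E ->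
  (\int[P]_w f (X w) = \int[normal_prob 0 1]_x f x)%E.
Proof.
move=> mX lawX mf f0.
(* [normal_prob] and [lebesgue_measure] live on [measurableTypeR R], whose
   display differs from that of the canonical structure on [R] *)
pose G := measurableTypeR R.
have mXG : measurable_fun setT (X : T -> G) by exact: mX.
have mfG : measurable_fun setT (f : G -> \bar R) by exact: mf.
transitivity (\int[pushforward P (X : T -> G)]_x f x)%E.
  by rewrite ge0_integral_pushforward.
by apply: eq_measure_integral => A mA _; exact: lawX.
Qed.

Lemma expectation_normal_mgf (R : realType) (dT : measure_display)
    (T : measurableType dT) (P : probability T R) (X : T -> R) (r : R) :
  measurable_fun setT X ->
  (forall B : set R, measurable B -> P (X @^-1` B) = normal_prob 0 1 B) ->
  (\int[P]_w (expR (r * X w))%:E = (expR (r ^+ 2 / 2))%:E)%E.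
Proof.
move=> mX lawX; rewrite -normal_mgf.
apply: (@ge0_expectation_normal _ _ _ _ _ (fun x => (expR (r * x))%:E)) => //.
by apply/measurable_EFinP; apply: measurableT_comp.
Qed.

(** From [1 + y^2 / 2 <= expR y] at [y = |x|]. The two terms are written so as to match the moment
    generating function at 1 and -1. *)
Lemma sqr_le_expR (R : realType) (x : R) : x ^+ 2 <= 2 * (expR (1 * x) + expR (- 1 * x)).
Proof.
have h (y : R) : 0 <= y -> y ^+ 2 <= 2 * expR y.
  by move=> /(expR_ge1Dxn 1) /=; rewrite -[X in _ / X]/2; lra.
rewrite mul1r mulN1r.
have := expR_ge0 x; have := expR_ge0 (- x).
have [x0|x0] := leP 0 x; first by have := h _ x0; lra.
have /h : 0 <= - x by lra.
by rewrite sqrrN; lra.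
Qed.

(** The constant is [2 * (M(1) + M(-1))], where M is the moment generating function. A fixed
    constant is enough, as the error bounds divide it by diverging quantities. *)
Lemma normal_second_moment (R : realType) (dT : measure_display)
    (T : measurableType dT) (P : probability T R) (X : T -> R) :
  measurable_fun setT X ->
  (forall B : set R, measurable B -> P (X @^-1` B) = normal_prob 0 1 B) ->
  (\int[P]_w (X w ^+ 2)%:E <= (4 * expR (1 / 2))%:E)%E.
Proof.
move=> mX lawX.
have mexp r : measurable_fun setT (fun w => expR (r * X w)).
  by apply: measurableT_comp => //; exact: measurable_funM.
have -> : (4 * expR (1 / 2))%:E =
   (\int[P]_w (2%:E * ((expR (1 * X w))%:E + (expR (- 1 * X w))%:E)))%E.
  rewrite ge0_integralZl//; first last.
  - by move=> w _; rewrite -EFinD lee_fin addr_ge0 ?expR_ge0.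
  - by apply: emeasurable_funD; apply/measurable_EFinP; exact: mexp.
  rewrite ge0_integralD//.
  - rewrite !expectation_normal_mgf// -EFinD -EFinM; congr EFin.
    by rewrite sqrrN !expr1n; lra.
  - by apply/measurable_EFinP; exact: mexp.
  - by apply/measurable_EFinP; exact: mexp.
apply: ge0_le_integral => //.
- by move=> w _; rewrite lee_fin sqr_ge0.
- by apply/measurable_EFinP; exact: measurable_funX.
- apply: emeasurable_funM => //.
  by apply: emeasurable_funD; apply/measurable_EFinP; exact: mexp.
- by move=> w _; rewrite -EFinD -EFinM lee_fin sqr_le_expR.
Qed.

Lemma normal_Lfun2 (R : realType) (dT : measure_display)
    (T : measurableType dT) (P : probability T R) (X : T -> R) :
  measurable_fun setT X ->
  (forall B : set R, measurable B -> P (X @^-1` B) = normal_prob 0 1 B) ->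
  X \in Lfun P 2%:E.
Proof.
move=> mX lawX; apply: Lfun2P => //.
by rewrite (le_lt_trans (normal_second_moment mX lawX))// ltry.
Qed.

(* Taking expectations in [1 + r * X <= expR (r * X)] gives
   [r * E X <= expR (r^2 / 2) - 1 <= r^2] for all [|r| <= 1]; let [r] tend to 0
   from both sides. *)
Lemma normal_mean (R : realType) (dT : measure_display)
    (T : measurableType dT) (P : probability T R) (X : T -> R) :
  measurable_fun setT X ->
  (forall B : set R, measurable B -> P (X @^-1` B) = normal_prob 0 1 B) ->
  ('E_P[X] = 0)%E.
Proof.
move=> mX lawX.
have X1 := Lfun_subset12 (fin_num_measure P _ measurableT) (normal_Lfun2 mX lawX).
have iX : P.-integrable setT (EFin \o X) by exact/Lfun1_integrable.
have fX := expectation_fin_num X1.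
suff h (r : R) : `|r| <= 1 -> r * fine 'E_P[X]%E <= r ^+ 2.
  rewrite -(fineK fX); congr EFin; apply/eqP; rewrite eq_le.
  set e := fine _ in h *.
  have hle (r : R) : 0 < r -> r <= 1 -> `|e| <= r.
    move=> r0 r1; rewrite ler_norml; apply/andP; split.
    - have := h (- r); rewrite normrN gtr0_norm// => /(_ r1); nra.
    - have := h r; rewrite gtr0_norm// => /(_ r1); nra.
  rewrite -eq_le -normr_eq0 eq_le normr_ge0 andbT leNgt; apply/negP => e0.
  (* This radius is positive if [e] is nonzero, and [|e| <= |e| / 2] is then absurd. *)
  have := hle (Num.min 1 (`|e| / 2)).
  rewrite lt_min ltr01 divr_gt0// ge_min lexx => /(_ isT isT).
  by rewrite le_min => /andP[_]; lra.
move=> r1.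
have r21 : r ^+ 2 <= 1 by rewrite -real_normK ?num_real// expr_le1.
suff : 1 + r * fine 'E_P[X]%E <= expR (r ^+ 2 / 2).
  (* With [s = r^2] and [E = expR (s / 2)], this gives [E * (1 - s / 2) <= 1]; since
     [(1 + s) * (1 - s / 2) >= 1] for [0 <= s <= 1], it follows that [E <= 1 + s]. *)
  have := expR_ge1Dx (- (r ^+ 2 / 2)).
  rewrite expRN => h1 h2.
  have e0 := expR_gt0 (r ^+ 2 / 2).
  set E := expR _ in h1 h2 e0.
  have h3 : E * (1 - r ^+ 2 / 2) <= 1.
    by rewrite mulrC -ler_pdivlMr// div1r.
  set s := r ^+ 2 in r21 h1 h3 *.
  have s0 : 0 <= s by exact: sqr_ge0.
  set q := r * _ in h2 *.
  nra.
rewrite -lee_fin -(expectation_normal_mgf r mX lawX) EFinD EFinM (fineK fX).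
rewrite [in leLHS]unlock -integralZl// -[X in (X + _ <= _)%E]mule1 -[X in (_ * X + _ <= _)%E](@probability_setT _ _ _ P).
rewrite -integral_cst// -integralD//=; last 2 first.
- exact: finite_measure_integrable_cst.
- exact: integrableZl.
apply: le_integral => //.
- apply: integrableD => //.
  + exact: finite_measure_integrable_cst.
  + exact: integrableZl.
- apply/integrableP; split.
    by apply/measurable_EFinP; apply: measurableT_comp => //; exact: measurable_funM.
  under eq_integral do rewrite gee0_abs ?lee_fin ?expR_ge0//.
  by rewrite expectation_normal_mgf// ltry.
- by move=> w _; rewrite -EFinM -EFinD lee_fin expR_ge1Dx.
Qed.

(** * Non-asymptotic error bounds of the two tests *)

(** When the square is expanded, only the diagonal terms survive. *)
Lemma second_moment_sum (R : realType) (dT : measure_display) (T : measurableType dT)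
    (P : probability T R) (I : finType) (Z : I -> T -> R) (v : R) :
  (forall i, Z i \in Lfun P 2%:E) ->
  (forall i j, i != j -> 'E_P[Z i \* Z j] = 0)%E ->
  (forall i, \int[P]_w (Z i w ^+ 2)%:E <= v%:E)%E ->
  (\int[P]_w ((\sum_i Z i w) ^+ 2)%:E <= (#|I|%:R * v)%:E)%E.
Proof.
move=> Z2 Zij Zv.
have iZ i j : P.-integrable setT (fun w => (Z i w * Z j w)%:E).
  by apply/(@Lfun1_integrable _ _ _ P (Z i \* Z j)); exact: Lfun2_mul_Lfun1.
under eq_integral.
  move=> w _; rewrite expr2 big_distrlr/= -sumEFin.
  under eq_bigr do rewrite -sumEFin.
  over.
rewrite integral_sum//; last by move=> i; apply: integrable_sum.
rewrite mulrC mulr_natr -sumr_const -sumEFin; apply: lee_sum => i _.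
rewrite integral_sum// (bigD1 i)//= big1 ?adde0; first exact: Zv.
by move=> j ji; have := Zij i j; rewrite eq_sym unlock => /(_ ji).
Qed.

Lemma measurable_set_ltr (R : realType) (dT : measure_display) (T : measurableType dT)
    (f g : T -> R) : measurable_fun setT f -> measurable_fun setT g ->
  measurable [set w | f w < g w].
Proof.
move=> mf mg; rewrite (_ : [set w | _] = setT `&` (fun w => f w < g w) @^-1` [set true]).
  by apply: (measurable_fun_ltr mf mg).
by rewrite setTI; apply/seteqP; split.
Qed.

Lemma measurable_set_ler (R : realType) (dT : measure_display) (T : measurableType dT)
    (f g : T -> R) : measurable_fun setT f -> measurable_fun setT g ->
  measurable [set w | f w <= g w].
Proof.
move=> mf mg; rewrite (_ : [set w | _] = setT `&` (fun w => f w <= g w) @^-1` [set true]).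
  by apply: (measurable_fun_ler mf mg).
by rewrite setTI; apply/seteqP; split.
Qed.

(** The support of the planted tensor is the Cartesian product of the [I j]. *)
Lemma sum_chc_tensor (R : realType) (d : nat) (n : 'I_d -> nat) (lam : R)
    (I : forall j : 'I_d, {set 'I_(n j)}) :
  \sum_(i : Idx n) chc_tensor lam I i = lam * \prod_(j < d) #|I j|%:R.
Proof.
rewrite -natr_prod -cardsXn mulr_natr -sumr_const [RHS]big_mkcond/=.
by apply: eq_bigr => i _; rewrite /chc_tensor in_setXn.
Qed.

Section thresholds.
Variables (R : realType) (d : nat).

Definition max_threshold (n : 'I_d -> nat) : R :=
  Num.sqrt (2 * \sum_(j < d) ln ((n j)%:R : R)).

(** The shift of the normalised sum caused by a planted block of height exactly [lam], the weakest
    alternative. *)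
Definition signal_strength (n k : 'I_d -> nat) (lam : R) : R :=
  lam * (\prod_(j < d) (k j)%:R) / Num.sqrt (\prod_(j < d) (n j)%:R).

End thresholds.

Section std_gaussian.
Variables (R : realType) (dT : measure_display) (T : measurableType dT).
Variables (P : probability T R) (d : nat) (n : 'I_d -> nat).
Variable (Z : Idx n -> T -> R).
Hypothesis gZ : std_gaussian_tensor P Z.

Let mZ i : measurable_fun setT (Z i). Proof. by case: gZ. Qed.

Let lawZ i (B : set R) : measurable B -> P (Z i @^-1` B) = normal_prob 0 1 B.
Proof. by case: gZ => _ + _ => /[apply]. Qed.

(** Joint independence is specialised by taking [setT], of probability one, at all other indices. *)
Lemma std_gaussian_indep i j (A B : set R) : i != j -> measurable A -> measurable B ->
  P (Z i @^-1` A `&` Z j @^-1` B) = (P (Z i @^-1` A) * P (Z j @^-1` B))%E.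
Proof.
move=> ij mA mB; case: gZ => _ _ indep.
pose C k := if k == i then A else if k == j then B else setT.
have mC k : measurable (C k) by rewrite /C; case: ifP => // _; case: ifP.
have Ci : C i = A by rewrite /C eqxx.
have Cj : C j = B by rewrite /C eq_sym (negbTE ij) eqxx.
transitivity (P (\bigcap_(k in setT) (Z k @^-1` C k))).
  congr (P _); apply/seteqP; split => [w [wA wB] k _|w wC].
    by rewrite /C; case: eqVneq => [->//|_]; case: eqVneq => [->//|_].
  by split; [have := wC i I; rewrite Ci|have := wC j I; rewrite Cj].
rewrite indep// (bigD1 i)//= (bigD1 j) 1?eq_sym//= Ci Cj big1 ?mule1// => k /andP[ki kj].
by rewrite /C (negbTE ki) (negbTE kj) preimage_setT probability_setT.
Qed.

Lemma std_gaussian_sum_second_moment :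
  (\int[P]_w ((\sum_i Z i w) ^+ 2)%:E <= (#|Idx n|%:R * (4 * expR (1 / 2)))%:E)%E.
Proof.
have Z2 i := normal_Lfun2 (mZ i) (@lawZ i).
apply: second_moment_sum => // [i j ij|i].
- rewrite (expectation_mul_indep (Z2 i) (Z2 j)).
    by rewrite (normal_mean (mZ i) (@lawZ i)) mul0e.
  by move=> A B mA mB; exact: std_gaussian_indep.
- exact: (normal_second_moment (mZ i) (@lawZ i)).
Qed.

Let mS : measurable_fun setT (fun w => \sum_i Z i w).
Proof. exact: measurable_sum. Qed.

Lemma card_Idx : #|Idx n| = (\prod_(j < d) n j)%N.
Proof.
rewrite card_dep_ffun foldrE big_map big_enum/=.
by apply: eq_bigr => j _; rewrite card_ord.
Qed.

(** Chebyshev for the raw sum at level [a * sqrt N], N the number of entries: the factor N of the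
    second moment cancels, so the bound does not depend on the dimensions. *)
Lemma std_gaussian_sum_tail a : 0 < a -> (forall j, (0 < n j)%N) ->
  (P [set w | (a <= `|(\sum_i Z i w) / Num.sqrt (\prod_(j < d) (n j)%:R)|)%R] <=
   (4 * expR (1 / 2) / a ^+ 2)%:E)%E.
Proof.
move=> a0 n0.
have N0 : 0 < \prod_(j < d) (n j)%:R :> R by apply: prodr_gt0 => j _; rewrite ltr0n.
have s0 : 0 < Num.sqrt (\prod_(j < d) (n j)%:R) :> R by rewrite sqrtr_gt0.
have := markov_sqr mS (mulr_gt0 a0 s0) std_gaussian_sum_second_moment.
rewrite exprMn sqr_sqrtr ?(ltW N0)// card_Idx natr_prod.
have -> : [set w | (a <= `|(\sum_i Z i w) / Num.sqrt (\prod_(j < d) (n j)%:R)|)%R] =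
  [set w | (a * Num.sqrt (\prod_(j < d) (n j)%:R) <= `|\sum_i Z i w|)%R].
  by apply/seteqP; split => w /=; rewrite normrM normfV (gtr0_norm s0) ler_pdivlMr.
by congr (_ <= _%:E)%E; field; rewrite !gt_eqF.
Qed.

Lemma measurable_psi_max_noise (X : Idx n -> R) :
  measurable [set w | psi_max (fun i => X i + Z i w)].
Proof.
have -> : [set w | psi_max (fun i => X i + Z i w)] =
  \bigcup_(i in [set: Idx n])
    [set w | Num.sqrt (2 * \sum_(j < d) ln ((n j)%:R : R)) < X i + Z i w].
  by apply/seteqP; split => [w /existsP[i iw]|w [i _ iw]]; [exists i|apply/existsP; exists i].
apply: fin_bigcup_measurable => // i _.
apply: measurable_set_ltr => //; exact: measurable_funD.
Qed.

Lemma measurable_psi_sum_noise W (X : Idx n -> R) :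
  measurable [set w | psi_sum W (fun i => X i + Z i w)].
Proof.
apply: measurable_set_ltr => //.
apply: measurable_funM => //; apply: measurable_sum => i.
exact: measurable_funD.
Qed.

Let noise0 w : Z ^~ w = (fun i => 0 + Z i w).
Proof. by apply/funext => i; rewrite add0r. Qed.

Let normS : measurable_fun setT
  (fun w => `|(\sum_i Z i w) / Num.sqrt (\prod_(j < d) (n j)%:R)|).
Proof. by apply: measurableT_comp => //; exact: measurable_funM. Qed.

Lemma psi_sum_null W : 0 < W -> (forall j, (0 < n j)%N) ->
  (P [set w | psi_sum W (Z ^~ w)] <= (4 * expR (1 / 2) / W ^+ 2)%:E)%E.
Proof.
move=> W0 n0; apply: le_trans (std_gaussian_sum_tail W0 n0).
apply: le_measure; rewrite ?inE.
- under eq_set do rewrite noise0; exact: measurable_psi_sum_noise.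
- exact: measurable_set_ler.
- by move=> w /= /ltW /le_trans; apply; exact: ler_norm.
Qed.

(** The signal shifts the statistic by at least [signal_strength n k lam], so a miss forces the
    noise down to [W - signal_strength n k lam] or below. *)
Lemma psi_sum_alt (k : 'I_d -> nat) (lam : R) W (X : Idx n -> R) :
  W < signal_strength n k lam -> (forall j, (0 < n j)%N) -> chc_class k lam X ->
  (P [set w | ~~ psi_sum W (fun i => (X i + Z i w)%R)] <=
   (4 * expR (1 / 2) / (signal_strength n k lam - W) ^+ 2)%:E)%E.
Proof.
move=> Wmu n0 [lam' [I [lamlam' [Ik XE]]]].
have Wmu0 : 0 < signal_strength n k lam - W by rewrite subr_gt0.
apply: le_trans (std_gaussian_sum_tail Wmu0 n0).
apply: le_measure; rewrite ?inE.
- rewrite [X in measurable X](_ : _ = ~` [set w | psi_sum W (fun i => X i + Z i w)]).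
    exact/measurableC/measurable_psi_sum_noise.
  by apply/seteqP; split => w /negP.
- exact: measurable_set_ler.
move=> w /=; rewrite /psi_sum -leNgt big_split/= XE sum_chc_tensor mulrDl.
set S := (\sum_i Z i w) / _ => SW.
have mumu' : signal_strength n k lam <= lam' * (\prod_(j < d) #|I j|%:R) / Num.sqrt (\prod_(j < d) (n j)%:R).
  under eq_bigr do rewrite Ik.
  by rewrite !ler_wpM2r ?invr_ge0 ?sqrtr_ge0// prodr_ge0.
by rewrite ler_normr; apply/orP; right; lra.
Qed.

Let thr := max_threshold R n.

(** Union bound by induction on a list of indices; measurability is carried along because
    subadditivity requires it at each step. *)
Lemma std_gaussian_max_tail (t : R) (s : seq (Idx n)) : 0 < t ->
  measurable [set w | has (fun i => t < Z i w) s] /\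
  (P [set w | has (fun i => (t < Z i w)%R) s] <=
   ((size s)%:R * (normal_peak 1 * expR (- (t ^+ 2 / 2)) / t))%:E)%E.
Proof.
move=> t0; elim: s => [|i s [ms IH]].
  rewrite [X in measurable X /\ (P X <= _)%E](_ : _ = set0) ?mul0r ?measure0//.
  by apply/seteqP; split.
rewrite [X in measurable X /\ (P X <= _)%E](_ : _ =
  [set w | t < Z i w] `|` [set w | has (fun i => t < Z i w) s]); last first.
  apply/seteqP; split => w /=; first by move=> /orP.
  by move=> /orP.
have mi : measurable [set w | t < Z i w] by exact: measurable_set_ltr.
split; first exact: measurableU.
apply: le_trans (measureU2 _ mi ms) _.
rewrite /= -natr1 mulrDl mul1r EFinD addeC; apply: leeD => //.
rewrite [X in P X](_ : _ = Z i @^-1` `]t, +oo[); last first.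
  by apply/seteqP; split => w /=; rewrite in_itv/= andbT.
by rewrite lawZ//; exact: normal_tail.
Qed.

Lemma sum_ln_ln_prod : (forall j, (0 < n j)%N) ->
  \sum_(j < d) ln ((n j)%:R : R) = ln (\prod_(j < d) (n j)%:R).
Proof.
move=> n0; apply/esym.
(* Positivity of the partial products joins the induction, since [lnM] asks for positive factors. *)
suff : 0 < \prod_(j < d) ((n j)%:R : R) /\
   ln (\prod_(j < d) (n j)%:R : R) = \sum_(j < d) ln ((n j)%:R) by case.
elim/big_rec2 : _ => [|j x y _ [y0 yx]]; first by rewrite ln1.
have nj0 : 0 < (n j)%:R :> R by rewrite ltr0n.
by rewrite mulr_gt0// lnM ?posrE// yx.
Qed.

Lemma psi_max_null : 0 < thr -> (forall j, (0 < n j)%N) ->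
  (P [set w | psi_max (Z ^~ w)] <= (normal_peak 1 / thr)%:E)%E.
Proof.
move=> t0 n0; have [_] := std_gaussian_max_tail (enum (Idx n)) t0.
rewrite -cardE card_Idx natr_prod sqr_sqrtr; last first.
  by rewrite ltW// -sqrtr_gt0.
rewrite sum_ln_ln_prod//; set N := \prod_(j < d) _.
have N0 : 0 < N by apply: prodr_gt0 => j _; rewrite ltr0n.
(* The threshold is calibrated for this: the Gaussian factor cancels the N of the union bound. *)
have -> : expR (- (2 * ln N / 2)) = N^-1.
  by rewrite (_ : 2 * ln N / 2 = ln N) ?expRN ?lnK//; field.
have -> : N * (normal_peak 1 / N / thr) = normal_peak 1 / thr.
  by field; rewrite !gt_eqF.
rewrite [X in (P X <= _)%E -> _](_ : _ = [set w | psi_max (Z ^~ w)])//.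
apply/seteqP; split => w /=.
  by move=> /hasP[i _ ti]; apply/existsP; exists i.
by move=> /existsP[i ti]; apply/hasP; exists i; rewrite ?mem_enum.
Qed.

Lemma psi_max_alt (k : 'I_d -> nat) (lam : R) (X : Idx n -> R) :
  thr < lam -> (forall j, (0 < k j)%N) -> chc_class k lam X ->
  (P [set w | ~~ psi_max (fun i => (X i + Z i w)%R)] <=
   (4 * expR (1 / 2) / (lam - thr) ^+ 2)%:E)%E.
Proof.
move=> tlam k0 [lam' [I [lamlam' [Ik XE]]]].
(* One entry of the planted block is enough; the block is nonempty because every [k j] is
   positive. *)
have [i iI] : exists i : Idx n, i \in setXn I.
  apply/set0Pn; rewrite -card_gt0 cardsXn prodn_gt0// => j.
  by rewrite Ik.
have d0 : 0 < lam - thr by rewrite subr_gt0.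
apply: le_trans (markov_sqr (mZ i) d0 (normal_second_moment (mZ i) (@lawZ i))).
apply: le_measure; rewrite ?inE.
- rewrite [X in measurable X](_ : _ = ~` [set w | psi_max (fun i => X i + Z i w)]).
    exact/measurableC/measurable_psi_max_noise.
  by apply/seteqP; split => w /negP.
- by apply: measurable_set_ler => //; exact: measurableT_comp.
move=> w /= /existsPn /(_ i); rewrite -leNgt XE /chc_tensor.
rewrite in_setXn in iI; rewrite iI -/(max_threshold R n) -/thr => h.
by rewrite ler_normr; apply/orP; right; lra.
Qed.

(* [k <= n] makes the class of alternatives nonempty; otherwise the supremum in
   the risk would be [-oo]. *)
Lemma chc_risk_le (k : 'I_d -> nat) (lam : R) W e :
  0 < W -> 0 < thr -> (forall j, (0 < n j)%N) -> (forall j, (k j <= n j)%N) ->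
  (forall X : Idx n -> R, chc_class k lam X ->
    P [set w | ~~ psi_sum W (fun i => (X i + Z i w)%R)] <= e%:E \/
    P [set w | ~~ psi_max (fun i => (X i + Z i w)%R)] <= e%:E)%E ->
  (0 <= e)%R ->
  (0 <= chc_risk P k lam W Z <=
    (4 * expR (1 / 2) / W ^+ 2 + normal_peak 1 / thr + e)%:E)%E.
Proof.
move=> W0 t0 n0 kn He e0.
have mnull : measurable [set w | psi_sum W (Z ^~ w)].
  under eq_set do rewrite noise0; exact: measurable_psi_sum_noise.
have mnull' : measurable [set w | psi_max (Z ^~ w)].
  under eq_set do rewrite noise0; exact: measurable_psi_max_noise.
apply/andP; split.
  rewrite /chc_risk adde_ge0//.
  (* The first [k j] indices of each mode give an explicit alternative, whose error probability
     bounds the supremum from below. *)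
  pose I (j : 'I_d) : {set 'I_(n j)} := finset (fun i : 'I_(n j) => (i < k j)%N).
  apply: le_trans (ereal_sup_ubound _); last first.
    exists (chc_tensor lam I) => //; exists lam, I; split; [by []|split => // j].
    by rewrite -sum1dep_card (big_ord_narrow (kn j)) sum1_card card_ord.
  exact: measure_ge0.
rewrite EFinD; apply: leeD.
  rewrite [X in P X](_ : _ =
    [set w | psi_sum W (Z ^~ w)] `|` [set w | psi_max (Z ^~ w)]); last first.
    by apply/seteqP; split => w /=; move=> /orP.
  apply: le_trans (measureU2 _ mnull mnull') _.
  by rewrite EFinD; apply: leeD; [exact: psi_sum_null|exact: psi_max_null].
apply: ge_ereal_sup => _ [X HX <-].
have ms := measurable_psi_sum_noise W X.
have mm := measurable_psi_max_noise X.
have mc : measurable [set w | ~~ psi_c W (fun i => X i + Z i w)].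
  rewrite [X in measurable X](_ : _ = ~` ([set w | psi_sum W (fun i => X i + Z i w)] `|`
      [set w | psi_max (fun i => X i + Z i w)])).
    by apply: measurableC; exact: measurableU.
  apply/seteqP; split => w /=; first by move=> /negP h /orP.
  by move=> h; apply/negP => /orP.
(* The combined test misses only when both tests miss, so either bound suffices for this [X]. *)
have [|] := He _ HX => /(le_trans _); apply; apply: le_measure; rewrite ?inE//.
- rewrite [X in measurable X](_ : _ = ~` [set w | psi_sum W (fun i => X i + Z i w)]).
    exact: measurableC.
  by apply/seteqP; split => w /negP.
- by move=> w /=; rewrite negb_or => /andP[].
- rewrite [X in measurable X](_ : _ = ~` [set w | psi_max (fun i => X i + Z i w)]).
    exact: measurableC.
  by apply/seteqP; split => w /negP.
- by move=> w /=; rewrite negb_or => /andP[].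
Qed.
End std_gaussian.

(** * Asymptotics *)

Lemma cvg_div_pinfty (R : realType) (c : R) (u : nat -> R) :
  u @ \oo --> +oo -> (fun m => c / u m) @ \oo --> (0 : R).
Proof.
move=> /cvgryPge uy; apply/cvgrPdist_le => e e0.
near=> m.
(* The added 1 keeps [u m] positive even if [c = 0]. *)
have um : `|c| / e + 1 <= u m by near: m; exact: uy.
have u0 : 0 < u m by rewrite (lt_le_trans _ um)// ltr_pwDr// divr_ge0// ltW.
rewrite sub0r normrN normrM normfV (gtr0_norm u0) ler_pdivrMr// mulrC -ler_pdivrMr//.
by rewrite (le_trans _ um)// lerDl.
Unshelve. all: by end_near. Qed.

(** The lower limit is the supremum of the tail infima, so one of them exceeds [a] and serves as
    [r]; it is finite, lying between [a] and a term of the sequence. *)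
Lemma lt_limn_einf_near (R : realType) (u : nat -> R) (a : R) :
  (a%:E < limn_einf (EFin \o u))%E -> exists2 r, a < r & \forall m \near \oo, r <= u m.
Proof.
rewrite limn_einf_lim (cvg_lim _ (@cvg_einfs_sup _ _))//.
move=> /ereal_sup_gt[_ [N _ <-] aN].
have uN m : (N <= m)%N -> (einfs (EFin \o u) N <= (u m)%:E)%E.
  by move=> Nm; apply: ereal_inf_lbound; exists m.
have fN : einfs (EFin \o u) N \is a fin_num.
  rewrite fin_numE gt_eqF ?(le_lt_trans (leNye _) aN)// lt_eqF//.
  by rewrite (le_lt_trans (uN N (leqnn _)))// ltry.
exists (fine (einfs (EFin \o u) N)); first by rewrite -lte_fin fineK.
by exists N => // m /= Nm; rewrite -lee_fin fineK// uN.
Qed.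

Lemma cvg_ln_natr_pinfty (R : realType) (u : nat -> nat) : (fun m => (u m)%:R : R) @ \oo --> +oo ->
  (fun m => ln ((u m)%:R : R)) @ \oo --> +oo.
Proof.
move=> /cvgryPge uy; apply/cvgryPge => A; near=> m.
have um : expR A <= (u m)%:R by near: m; exact: uy.
by rewrite -[leLHS]expRK ler_ln ?posrE ?expR_gt0// (lt_le_trans _ um) ?expR_gt0.
Unshelve. all: by end_near. Qed.

Section asymptotics.
Variables (R : realType) (d : nat).

Lemma near_n_gt0 (n : nat -> 'I_d -> nat) :
  (forall j, (fun m => (n m j)%:R : R) @ \oo --> +oo) ->
  \forall m \near \oo, forall j, (0 < n m j)%N.
Proof.
move=> ny; apply: filter_forall => j; move/cvgryPgt : (ny j) => /(_ 0).
by apply: filterS => m; rewrite ltr0n.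
Qed.

(** A single mode makes the sum of logarithms diverge, and the other terms are eventually
    nonnegative. *)
Lemma cvg_max_threshold (n : nat -> 'I_d -> nat) : (0 < d)%N ->
  (forall j, (fun m => (n m j)%:R : R) @ \oo --> +oo) ->
  (fun m => max_threshold R (n m)) @ \oo --> +oo.
Proof.
move=> d0 ny; apply/cvgryPge => A; near=> m.
have n0 : forall j, (0 < n m j)%N by near: m; exact: near_n_gt0.
have An : A ^+ 2 <= ln ((n m (Ordinal d0))%:R : R).
  by near: m; move: (cvg_ln_natr_pinfty (ny (Ordinal d0))) => /cvgryPge; exact.
apply: (le_trans (ler_norm A)); rewrite -sqrtr_sqr; apply: ler_wsqrtr.
rewrite (bigD1 (Ordinal d0))//=.
have ln0 j : 0 <= ln ((n m j)%:R : R) by rewrite ln_ge0// ler1n.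
have := sumr_ge0 (index_enum 'I_d) (fun (j : 'I_d) (_ : j != Ordinal d0) => ln0 j).
have := ln0 (Ordinal d0).
lra.
Unshelve. all: by end_near. Qed.

Variables (dT : measure_display) (T : measurableType dT) (P : probability T R).

(** Here [g] is a diverging margin by which the signal clears the threshold of one of the tests;
    which test it is may vary with [m]. *)
Lemma cvg_chc_risk (n k : nat -> 'I_d -> nat) (lam W g : nat -> R)
    (Z : forall m, Idx (n m) -> T -> R) : (0 < d)%N ->
  (forall m, std_gaussian_tensor P (Z m)) ->
  (forall m j, (k m j <= n m j)%N) ->
  (forall j, (fun m => (n m j)%:R : R) @ \oo --> +oo) ->
  W @ \oo --> +oo -> g @ \oo --> +oo ->
  (\forall m \near \oo,
     g m <= signal_strength (n m) (k m) (lam m) - W m \/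
     g m <= lam m - max_threshold R (n m) /\ (forall j, 0 < k m j)%N) ->
  (fun m => chc_risk P (k m) (lam m) (W m) (Z m)) @ \oo --> 0%E.
Proof.
move=> d0 gZ kn ny Wy gy Hg.
pose v : R := 4 * expR (1 / 2).
have v0 : 0 <= v by rewrite mulr_ge0// expR_ge0.
(* The squares of the Chebyshev bounds are dropped, which only enlarges them once [W m] and [g m]
   are at least 1. *)
pose b m := (v / W m + normal_peak 1 / max_threshold R (n m) + v / g m)%:E.
have b0 : b @ \oo --> 0%E.
  apply: cvg_EFin; first by near=> m.
  rewrite -[0%R]addr0 -{1}[0%R]addr0; apply: cvgD; last exact: cvg_div_pinfty.
  apply: cvgD; apply: cvg_div_pinfty => //.
  exact: cvg_max_threshold.
apply: (@squeeze_cvge _ _ _ _ (fun=> 0%E) _ b) => //; last exact: cvg_cst.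
near=> m.
have n0 : forall j, (0 < n m j)%N by near: m; exact: near_n_gt0.
have W1 : 1 <= W m by near: m; move/cvgryPge : Wy; exact.
have g1 : 1 <= g m by near: m; move/cvgryPge : gy; exact.
have t0 : 0 < max_threshold R (n m).
  by near: m; move/cvgryPgt : (cvg_max_threshold d0 ny); exact.
have g0 : 0 < g m by rewrite (lt_le_trans _ g1).
have W0 : 0 < W m by rewrite (lt_le_trans _ W1).
have inv2 x : 1 <= x -> v / x ^+ 2 <= v / x.
  move=> x1; have x0 : 0 < x by rewrite (lt_le_trans _ x1).
  by rewrite ler_wpM2l// lef_pV2 ?posrE ?exprn_gt0// expr2 ler_peMr// ltW.
have invg x : g m <= x -> v / x ^+ 2 <= v / g m.
  move=> gx; apply: le_trans (inv2 _ (le_trans g1 gx)) _.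
  by rewrite ler_wpM2l// lef_pV2 ?posrE// (lt_le_trans g0).
have e0 : 0 <= v / g m by rewrite divr_ge0// ltW.
have /andP[-> /le_trans ->//] : (0 <= chc_risk P (k m) (lam m) (W m) (Z m) <=
    (v / W m ^+ 2 + normal_peak 1 / max_threshold R (n m) + v / g m)%:E)%E.
  apply: chc_risk_le => // X HX.
  have : g m <= signal_strength (n m) (k m) (lam m) - W m \/
     g m <= lam m - max_threshold R (n m) /\ (forall j, 0 < k m j)%N by near: m.
  move=> [gm|[gm k0]]; [left|right].
  - apply: le_trans (psi_sum_alt (gZ m) _ n0 HX) _.
      by rewrite -subr_gt0 (lt_le_trans g0 gm).
    by rewrite lee_fin; exact: invg.
  - apply: le_trans (psi_max_alt (gZ m) _ k0 HX) _.
      by rewrite -subr_gt0 (lt_le_trans g0 gm).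
    by rewrite lee_fin; exact: invg.
by rewrite lee_fin !lerD2r inv2.
Unshelve. all: by end_near. Qed.

End asymptotics.

(** * Growth of the signal on the logarithmic scale of regime (A2) *)

Lemma ln_sqrt (R : realType) (x : R) : 0 < x -> ln (Num.sqrt x) = ln x / 2.
Proof.
move=> x0; rewrite -[in RHS](sqr_sqrtr (ltW x0)) lnXn ?sqrtr_gt0// -(mulr_natr (ln _)).
by rewrite mulfK ?pnatr_eq0.
Qed.

Section regimes.
Variables (R : realType) (d : nat).

Lemma signal_strength_gt0 (n k : 'I_d -> nat) (lam : R) : 0 < lam ->
  (forall j, (0 < n j)%N) -> (forall j, (0 < k j)%N) ->
  0 < signal_strength n k lam.
Proof.
move=> lam0 n0 k0; rewrite divr_gt0//; last first.
  by rewrite sqrtr_gt0 prodr_gt0// => j _; rewrite ltr0n.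
by rewrite mulr_gt0// prodr_gt0// => j _; rewrite ltr0n.
Qed.

(** The logarithm is linear in the quantities whose growth (A2) prescribes; [- ln lam^-1] is kept in
    the form of that hypothesis. *)
Lemma ln_signal_strength (n : 'I_d -> nat) (k : nat) (lam : R) : 0 < lam ->
  (forall j, (0 < n j)%N) -> (0 < k)%N ->
  ln (signal_strength n (fun=> k) lam) =
  - ln lam^-1 + d%:R * ln (k%:R : R) - (\sum_(j < d) ln ((n j)%:R : R)) / 2.
Proof.
move=> lam0 n0 k0.
have N0 : 0 < \prod_(j < d) (n j)%:R :> R by apply: prodr_gt0 => j _; rewrite ltr0n.
have K0 : 0 < \prod_(j < d) k%:R :> R by apply: prodr_gt0 => j _; rewrite ltr0n.
rewrite /signal_strength ln_div ?posrE ?mulr_gt0 ?sqrtr_gt0// lnM ?posrE//.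
rewrite ln_sqrt// -!sum_ln_ln_prod// lnV ?posrE// opprK.
by rewrite sumr_const card_ord mulr_natl.
Qed.

(** The logarithm of the strength, divided by [L], tends to [del = d * alpha - d / 2 - beta > 0], so
    the strength is eventually at least [expR (del / 2 * L m)]. *)
Lemma cvg_signal_strength (alpha beta : R) (L : nat -> R) (n : nat -> 'I_d -> nat)
    (k : nat -> nat) (lam : nat -> R) :
  beta < d%:R * alpha - d%:R / 2 ->
  (forall m j, (0 < k m <= n m j)%N) ->
  (forall m, 0 < lam m) ->
  L @ \oo --> +oo ->
  (forall j, (fun m => ln ((n m j)%:R : R) / L m) @ \oo --> (1 : R)) ->
  (fun m => ln ((k m)%:R : R) / L m) @ \oo --> alpha ->
  (fun m => ln ((lam m)^-1) / L m) @ \oo --> beta ->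
  (0 < d)%N ->
  (fun m => signal_strength (n m) (fun=> k m) (lam m)) @ \oo --> +oo.
Proof.
move=> bd kn lam0 Ly nL kL lamL d0.
pose q m := - (ln ((lam m)^-1) / L m) + d%:R * (ln ((k m)%:R : R) / L m) -
            (\sum_(j < d) (ln ((n m j)%:R : R) / L m)) / 2.
have qc : q @ \oo --> - beta + d%:R * alpha - d%:R / 2.
  apply: cvgB; first by apply: cvgD; [exact: cvgN|apply: cvgM => //; exact: cvg_cst].
  apply: cvgM; last exact: cvg_cst.
  rewrite [X in _ --> X](_ : _ = \sum_(j < d) (1 : R)).
    by apply: cvg_big => [|j _]; [exact: add_continuous|exact: nL].
  by rewrite sumr_const card_ord.
pose del := - beta + d%:R * alpha - d%:R / 2.
have del0 : 0 < del by rewrite /del; lra.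
have k0 m : (0 < k m)%N by have /andP[] := kn m (Ordinal d0).
have n0 m j : (0 < n m j)%N by have /andP[/leq_trans] := kn m j; apply.
apply/cvgryPge => A; near=> m.
have L0 : 0 < L m by near: m; move/cvgryPgt : Ly; exact.
have LA : A / (del / 2) <= L m by near: m; move/cvgryPge : Ly; exact.
have qd : del / 2 <= q m.
  by near: m; apply: (cvgr_ge _ qc); rewrite -/del; lra.
have s0 : 0 < signal_strength (n m) (fun=> k m) (lam m).
  exact: signal_strength_gt0.
have -> : signal_strength (n m) (fun=> k m) (lam m) = expR (q m * L m).
  rewrite -[LHS](lnK (s0 : _ \is Num.pos)) ln_signal_strength//; congr expR.
  rewrite /q -mulr_suml.
  by field; rewrite gt_eqF.
apply: le_trans (expR_ge1Dx _).
have : A <= del / 2 * L m by rewrite mulrC -ler_pdivrMr// divr_gt0.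
have : del / 2 * L m <= q m * L m by rewrite ler_wpM2r// ltW.
lra.
Unshelve. all: by end_near. Qed.

(** [lam] grows at least like [expR (c * L)], while the squared threshold is at most linear in [L].
    The factor 2 leaves a margin as large as the threshold itself. *)
Lemma le_max_threshold (beta : R) (L : nat -> R) (n : nat -> 'I_d -> nat)
    (lam : nat -> R) :
  beta < 0 ->
  (forall m j, (0 < n m j)%N) ->
  (forall m, 0 < lam m) ->
  L @ \oo --> +oo ->
  (forall j, (fun m => ln ((n m j)%:R : R) / L m) @ \oo --> (1 : R)) ->
  (fun m => ln ((lam m)^-1) / L m) @ \oo --> beta ->
  \forall m \near \oo, 2 * max_threshold R (n m) <= lam m.
Proof.
move=> b0 n0 lam0 Ly nL lamL.
pose c := - beta / 2.
have c0 : 0 < c by rewrite /c; lra.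
near=> m.
have L0 : 0 < L m by near: m; move/cvgryPgt : Ly; exact.
(* The squared left-hand side is at most [16 * d * L], and [expR (2 * c * L)] is at least
   [2 * c^2 * L^2]; this bound on [L] compares them. *)
have LA : 8 * d%:R / c ^+ 2 <= L m by near: m; move/cvgryPge : Ly; exact.
have n2 : forall j, ln ((n m j)%:R : R) / L m <= 2.
  near: m; apply: filter_forall => j; apply: (cvgr_le _ (nL j)); lra.
have lamc : ln ((lam m)^-1) / L m <= - c.
  by near: m; apply: (cvgr_le _ lamL); rewrite /c; lra.
have lamE : expR (c * L m) <= lam m.
  rewrite -[leRHS](lnK (lam0 m : _ \is Num.pos)) ler_expR.
  by move: lamc; rewrite ler_pdivrMr// lnV ?posrE//; lra.
have S2 : \sum_(j < d) ln ((n m j)%:R : R) <= d%:R * (2 * L m).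
  rewrite -[d in d%:R]card_ord mulr_natl -sumr_const; apply: ler_sum => j _.
  by rewrite -ler_pdivrMr.
have S0 : 0 <= \sum_(j < d) ln ((n m j)%:R : R).
  by apply: sumr_ge0 => j _; rewrite ln_ge0// ler1n.
rewrite -ler_sqr ?nnegrE ?mulr_ge0 ?sqrtr_ge0 ?(ltW (lam0 m))//.
rewrite exprMn sqr_sqrtr ?mulr_ge0//.
apply: (@le_trans _ _ (expR (c * L m) ^+ 2)); last first.
  by rewrite ler_sqr ?nnegrE ?expR_ge0 ?(ltW (lam0 m)).
rewrite -expRM_natl.
have cL0 : 0 <= c * L m *+ 2 by rewrite mulrn_wge0// mulr_ge0// ltW.
have := expR_ge1Dxn 1 cL0; rewrite -[X in _ / X]/2.
rewrite ler_pdivrMr ?exprn_gt0// in LA.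
rewrite -mulr_natl.
set E := expR _ => h.
have : 8 * d%:R * L m <= L m * c ^+ 2 * L m by rewrite ler_wpM2r// ltW.
move: h; rewrite exprMn exprMn. nra.
Unshelve. all: by end_near. Qed.

End regimes.

(** * Reliable detection in the two regimes *)

Unset Implicit Arguments.

Theorem mainTheorem7 (d : nat) (hd : (0 < d)%N) (R : realType)
    (dT : measure_display) (T : measurableType dT) (P : probability T R) :
  (* Regime (A1) *)
  (forall (n k : nat -> 'I_d -> nat) (lam W : nat -> R)
          (Z : forall m, Idx (n m) -> T -> R),
     (forall m, std_gaussian_tensor P (Z m)) ->
     (forall m j, (k m j <= n m j)%N) ->
     (forall j, (fun m => (n m j)%:R : R) @ \oo --> +oo) ->
     (forall j, (fun m => (k m j)%:R : R) @ \oo --> +oo) ->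
     (forall j, (fun m => (k m j)%:R / (n m j)%:R : R) @ \oo --> (0 : R)) ->
     W @ \oo --> +oo ->
     ((fun m => lam m * (\prod_(j < d) (k m j)%:R)
                 / Num.sqrt (\prod_(j < d) (n m j)%:R)) @ \oo --> +oo /\
      (exists c : R, 0 < c < 1 /\
         forall m, W m <= c * (lam m * (\prod_(j < d) (k m j)%:R)
                               / Num.sqrt (\prod_(j < d) (n m j)%:R)))
      \/
      (1%:E < limn_einf (fun m =>
          (lam m / Num.sqrt (2 * \sum_(j < d) ln ((n m j)%:R : R)))%:E))%E) ->
     (fun m => chc_risk P (k m) (lam m) (W m) (Z m)) @ \oo --> 0%E)
  /\
  (* Regime (A2) *)
  (forall (alpha beta : R), 0 <= alpha <= 1 ->
     beta < Num.max (d%:R * alpha - d%:R / 2) 0 ->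
   forall (n0 : nat -> nat) (n : nat -> 'I_d -> nat) (k : nat -> nat)
          (lam : nat -> R) (Z : forall m, Idx (n m) -> T -> R),
     (forall m, std_gaussian_tensor P (Z m)) ->
     (forall m j, (0 < k m <= n m j)%N) ->
     (forall m, 0 < lam m) ->
     (fun m => (n0 m)%:R : R) @ \oo --> +oo ->
     (forall j, (fun m => ln ((n m j)%:R : R) / ln ((n0 m)%:R : R)) @ \oo --> (1 : R)) ->
     (fun m => ln ((k m)%:R : R) / ln ((n0 m)%:R : R)) @ \oo --> alpha ->
     (fun m => ln ((lam m)^-1) / ln ((n0 m)%:R : R)) @ \oo --> beta ->
     exists W : nat -> R,
       (fun m => chc_risk P (fun _ => k m) (lam m) (W m) (Z m)) @ \oo --> 0%E).
Proof.
split.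
- move=> n k lam W Z gZ kn ny ky _ Wy [[muy [c [/andP[c0 c1] Wc]]]|].
  (* Since [W] is at most [c] times the strength, the sum test keeps a fraction [1 - c] of it as
     margin. *)
  + apply: (@cvg_chc_risk _ _ _ _ _ n k lam W
      (fun m => (1 - c) * signal_strength (n m) (k m) (lam m))) => //.
      apply/cvgryPge => A; near=> m.
      rewrite mulrC -ler_pdivrMr ?subr_gt0//.
      by near: m; move/cvgryPge : muy; exact.
    apply: nearW => m; left.
    have := Wc m; rewrite -/(signal_strength (n m) (k m) (lam m)); lra.
  + move=> /lt_limn_einf_near[r r1 rlam].
    have ty := cvg_max_threshold hd ny.
    (* Eventually [lam] is at least [r] times the max threshold with [r > 1], which leaves the
       margin [r - 1] times that threshold. *)
    apply: (@cvg_chc_risk _ _ _ _ _ n k lam W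
      (fun m => (r - 1) * max_threshold R (n m))) => //.
      apply/cvgryPge => A; near=> m.
      rewrite mulrC -ler_pdivrMr ?subr_gt0//.
      by near: m; move/cvgryPge : ty; exact.
    near=> m; right; split; last by near: m; exact: (near_n_gt0 ky).
    have t0 : 0 < max_threshold R (n m) by near: m; move/cvgryPgt : ty; exact.
    have : r <= lam m / max_threshold R (n m) by near: m.
    by rewrite ler_pdivlMr//; lra.
- move=> alpha beta _ bmax n0 n k lam Z gZ kn lam0 n0y nL kL lamL.
  have Ly := cvg_ln_natr_pinfty n0y.
  have n_gt0 m j : (0 < n m j)%N by have /andP[/leq_trans] := kn m j; apply.
  have kn' m j : (k m <= n m j)%N by have /andP[] := kn m j.
  (* Eventually [ln (n m j)] is at least half of [ln (n0 m)], which diverges. *)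
  have ny j : (fun m => (n m j)%:R : R) @ \oo --> +oo.
    apply/cvgryPge => A; near=> m.
    have L0 : 0 < ln ((n0 m)%:R : R) by near: m; move/cvgryPgt : Ly; exact.
    have LA : A * 2 <= ln ((n0 m)%:R : R) by near: m; move/cvgryPge : Ly; exact.
    have n2 : 1 / 2 <= ln ((n m j)%:R : R) / ln ((n0 m)%:R : R).
      by near: m; apply: (cvgr_ge _ (nL j)); lra.
    move: n2; rewrite ler_pdivlMr// => n2.
    have -> : (n m j)%:R = expR (ln ((n m j)%:R : R)).
      by rewrite lnK// posrE ltr0n.
    by apply: le_trans (expR_ge1Dx _); lra.
  (* Below the maximum, [beta] is either below the first argument, where the sum test detects, or
     negative, where the max test does. *)
  have [bd|bd] := ltP beta (d%:R * alpha - d%:R / 2).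
  + have muy := cvg_signal_strength bd kn lam0 Ly nL kL lamL hd.
    (* Half the strength serves both as threshold and as margin. *)
    pose W m := signal_strength (n m) (fun=> k m) (lam m) / 2.
    have Wy : W @ \oo --> +oo.
      apply/cvgryPge => A; near=> m; rewrite ler_pdivlMr//.
      by near: m; move/cvgryPge : muy; exact.
    exists W; apply: (@cvg_chc_risk _ _ _ _ _ n (fun m _ => k m) lam W W) => //.
    by apply: nearW => m; left; rewrite /W; lra.
  + have b0 : beta < 0 by move: bmax; rewrite lt_max ltNge bd.
    (* The max test provides the power; a diverging [W] makes the false alarms of the sum test
       vanish. *)
    exists (fun m => m%:R).
    have ty := cvg_max_threshold hd ny.
    apply: (@cvg_chc_risk _ _ _ _ _ n (fun m _ => k m) lam (fun m => m%:R)
      (fun m => max_threshold R (n m))) => //.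
      exact: cvgr_idn.
    have := le_max_threshold b0 n_gt0 lam0 Ly nL lamL.
    apply: filterS => m hm; right; split; first by lra.
    by move=> j; have /andP[] := kn m j.
Unshelve. all: by end_near. Qed.
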